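(* Let $A\in\mathbb{R}^{n\times n}$, $B\in\mathbb{R}^{n\times m}$, and let $M=M^\top\ge0$ be $n\times n$; assume $(A,\sqrt{M})$ is observable and $(A,B)$ is stabilizable. Let $x,u$ be a trajectory and input of $\dot x=Ax+Bu$, with data matrices $\bar\phi,\bar\mu,\bar\psi,\bar\varrho$ (defined in the context) collected on intervals $[t_0,t_1],\dots,[t_{N-1},t_N]$, and assume that $\Delta=[\bar\phi,\,2\bar\mu]$ has full column rank. Suppose a symmetric matrix $S\in\mathbb{R}^{n\times n}$ and a scalar $\varpi$ form a feasible solution of $$S\hat\Pi+\hat\Pi S-\hat\Gamma_{xx}-\varpi\hat B\hat B^\top<0,\qquad S>0,\qquad \varpi>0,$$ where symmetric $\hat\Gamma_{xx},\hat\Pi\in\mathbb{R}^{n\times n}$ and $\hat\Gamma_{xu},\hat B\in\mathbb{R}^{n\times m}$ are given by $$\big[\mathrm{vec}_S(\hat\Gamma_{xx})^\top,\mathrm{vec}(\hat\Gamma_{xu})^\top\big]^\top=(\Delta^\top\Delta)^{-1}\Delta^\top\big(\bar\psi\,\mathrm{vec}_S(S)\big),$$ $$\big[\mathrm{vec}_S(\hat\Pi)^\top,\mathrm{vec}(\hat B)^\top\big]^\top=(\Delta^\top\Delta)^{-1}\Delta^\top\bar\varrho .$$ Then $\hat K=\frac{\varpi}{2}\hat B^\top S^{-1}$ is a stabilizing controller gain, i.e. with $u=-\hat Kx$ the closed-loop matrix $A-B\hat K$ is Hurwitz.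
   Context: $\otimes$ is the Kronecker product and $\mathrm{vec}$ is column-stacking. For $v\in\mathbb{R}^k$ and a symmetric $S\in\mathbb{R}^{k\times k}$, $v\otimes_S v$ and $\mathrm{vec}_S(S)$ are the symmetric Kronecker product and symmetric vectorization in $\mathbb{R}^{k(k+1)/2}$, normalized so that $\mathrm{vec}_S(S)^\top(v\otimes_S v)=v^\top Sv$. For $k=1,\dots,N$ (with $t_0<t_1<\dots<t_N$): - $\phi_{k-1,k}=\int_{t_{k-1}}^{t_k}x\otimes_S x\,d\tau$ - $\mu_{k-1,k}=\int_{t_{k-1}}^{t_k}u\otimes x\,d\tau$ - $\psi_{k-1,k}=x(t_k)\otimes_S x(t_k)-x(t_{k-1})\otimes_S x(t_{k-1})$ - $\varrho_{k-1,k}=x(t_k)^\top x(t_k)-x(t_{k-1})^\top x(t_{k-1})$. The matrices $\bar\phi,\bar\mu,\bar\psi$ and the vector $\bar\varrho$ have the transposes of these quantities as their $N$ rows. *)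

(* Defs.v *)
From HB Require Import structures.
From mathcomp Require Import all_boot all_order all_algebra.
From mathcomp Require Import all_classical all_reals all_analysis.
From mathcomp Require Import complex mxtens.
Set Implicit Arguments.
Unset Strict Implicit.
Unset Printing Implicit Defensive.
Import Order.TTheory GRing.Theory Num.Theory.
Import numFieldNormedType.Exports.
Local Open Scope classical_set_scope.
Local Open Scope ring_scope.

(* Strict definiteness includes symmetry, so that [P > 0] and [P < 0] are the
   usual matrix inequalities between symmetric matrices. *)
Definition posdefmx (R : realType) (n : nat) (P : 'M[R]_n) : Prop :=
  P^T = P /\ forall v : 'cV[R]_n, v != 0 -> 0 < (v^T *m P *m v) 0 0.

Definition negdefmx (R : realType) (n : nat) (P : 'M[R]_n) : Prop :=
  posdefmx (- P).

Definition possemidefmx (R : realType) (n : nat) (P : 'M[R]_n) : Prop :=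
  P^T = P /\ forall v : 'cV[R]_n, 0 <= (v^T *m P *m v) 0 0.

(* [Q] is the principal square root of [M]; it is unique when it exists. *)
Definition is_sqrtmx (R : realType) (n : nat) (M Q : 'M[R]_n) : Prop :=
  possemidefmx Q /\ Q *m Q = M.

Definition hurwitz (R : realType) (n : nat) (A : 'M[R]_n) : Prop :=
  forall z : complex R,
    eigenvalue (map_mx (real_complex R) A) z -> complex.Re z < 0.

Definition stabilizable (R : realType) (n m : nat)
    (A : 'M[R]_n) (B : 'M[R]_(n, m)) : Prop :=
  exists K : 'M[R]_(m, n), hurwitz (A - B *m K).

Definition free_motion (R : realType) (n : nat) (A : 'M[R]_n)
    (z : R -> 'cV[R]_n) : Prop :=
  forall (s : R) (i : 'I_n), is_derive s 1 (fun r => z r i 0) ((A *m z s) i 0).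

(* The output [C z] on any interval [0, T] determines the initial state. By
   linearity a known input would play no role, hence is omitted. *)
Definition observable (R : realType) (n p : nat)
    (A : 'M[R]_n) (C : 'M[R]_(p, n)) : Prop :=
  forall T : R, 0 < T ->
  forall z1 z2 : R -> 'cV[R]_n, free_motion A z1 -> free_motion A z2 ->
    (forall s : R, 0 <= s <= T -> C *m z1 s = C *m z2 s) -> z1 0 = z2 0.

Definition abs_continuous (R : realType) (a b : R) (f : R -> R) : Prop :=
  forall e : R, 0 < e -> exists2 d : R, 0 < d &
  forall (p : nat) (l r : 'I_p -> R),
    (forall k, a <= l k /\ l k <= r k /\ r k <= b) ->
    trivIset setT (fun k => `]l k, r k[%classic) ->
    \sum_(k < p) (r k - l k) < d ->
    \sum_(k < p) `|f (r k) - f (l k)| < e.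

(* Solutions of [x' = A x + B u] on [a, b] in the sense of Caratheodory: the
   input is merely integrable (so it may be discontinuous), the state is
   absolutely continuous, and the equation holds almost everywhere. *)
Definition trajectory (R : realType) (n m : nat)
    (A : 'M[R]_n) (B : 'M[R]_(n, m)) (a b : R)
    (x : R -> 'cV[R]_n) (u : R -> 'cV[R]_m) : Prop :=
  [/\ forall j : 'I_m, (@lebesgue_measure R).-integrable `[a, b]
                         (EFin \o (fun s => u s j 0)),
      forall i : 'I_n, abs_continuous a b (fun s => x s i 0)
    & {ae @lebesgue_measure R, forall s : R, s \in `[a, b] ->
        forall i : 'I_n, is_derive s 1 (fun r => x r i 0)
                           ((A *m x s + B *m u s) i 0)}].

(* Positions (column, row) of the lower triangle, diagonal included; [enum]
   lists them lexicographically, i.e. column by column. *)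
Definition tripos (k : nat) := {p : 'I_k * 'I_k | (p.1 <= p.2)%N}.

Definition symdim (k : nat) : nat := #|{: tripos k}|.

Lemma symdimE (k : nat) : symdim k = (k * k.+1)./2.
Proof.
rewrite /symdim card_sig.
have -> : #|[pred p : 'I_k * 'I_k | (p.1 <= p.2)%N]| =
          (\sum_(j < k) \sum_(i < k | (i <= j)%N) 1)%N.
  rewrite (exchange_big_dep xpredT) //= pair_big_dep /= sum1_card.
  by apply: eq_card.
have E (j : 'I_k) : (\sum_(i < k | (i <= j)%N) 1 = j.+1)%N.
  by rewrite -(big_ord_widen k (fun=> 1%N) (ltn_ord j)) sum1_card card_ord.
rewrite (eq_bigr _ (fun j _ => E j)) -(big_mkord predT succn) {E}.
elim: k => [|k IH]; first by rewrite big_nil.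
rewrite big_nat_recr // [in LHS]IH.
have E : (k.+1 * k.+2 = k * k.+1 + (k.+1).*2)%N.
  by rewrite mulnC -mul2n -mulnDl addn2.
rewrite [in RHS]E.
by rewrite halfD odd_double andbF add0n doubleK.
Qed.

(* Isometric normalization: off-diagonal entries carry a factor [sqrt 2], which
   makes [vecS S] and [symkron v] satisfy [vecS_symkron] below. *)
Definition vecS (R : realType) (k : nat) (S : 'M[R]_k) : 'cV[R]_(symdim k) :=
  \col_a let p := val (enum_val a) in
    (if p.1 == p.2 then 1 else Num.sqrt 2) * S p.2 p.1.

Definition symkron (R : realType) (k : nat) (v : 'cV[R]_k) :
    'cV[R]_(symdim k) := vecS (v *m v^T).

Lemma vecS_symkron (R : realType) (k : nat) (S : 'M[R]_k) (v : 'cV[R]_k) :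
  S^T = S -> (vecS S)^T *m symkron v = v^T *m S *m v.
Proof.
move=> /matrixP Ssym.
have {}Ssym i j : S j i = S i j by rewrite -(Ssym i j) mxE.
apply/matrixP => i0 j0; rewrite !ord1 {i0 j0} !mxE.
pose F (i j : 'I_k) := v i 0 * S i j * v j 0.
have FC i j : F j i = F i j by rewrite /F Ssym mulrC [v j 0 * _]mulrC mulrA.
transitivity (\sum_(a : tripos k)
    (if (val a).1 == (val a).2 then 1 else 2) * F (val a).1 (val a).2).
  rewrite [RHS](reindex _ (onW_bij _ (@enum_val_bij (tripos k)))) /=; apply: eq_bigr => a _.
  rewrite !mxE /= !mxE big_ord1 !mxE; set p := sval _; rewrite /F Ssym.
  rewrite [v _ 0 * v _ 0]mulrC.
  case: ifP => _; first by rewrite !mul1r mulrCA mulrA.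
  rewrite mulrACA -expr2 sqr_sqrtr ?ler0n //; congr (_ * _).
  by rewrite mulrCA mulrA.
transitivity (\sum_(p : 'I_k * 'I_k | (p.1 <= p.2)%N)
    (if p.1 == p.2 then 1 else 2) * F p.1 p.2).
  rewrite [RHS](reindex_omap (val : tripos k -> _) insub) /=; last first.
    by move=> p lep; rewrite insubT.
  by apply: eq_bigl => a; rewrite valK eqxx (valP a).
rewrite -(pair_big_dep xpredT (fun i j : 'I_k => (i <= j)%N)
  (fun i j : 'I_k => (if i == j then 1 else 2) * F i j)) /=.
transitivity (\sum_i \sum_j F i j); last first.
  rewrite exchange_big /=; apply: eq_bigr => j _.
  by rewrite !mxE big_distrl /=; apply: eq_bigr => i _; rewrite mxE.
have lowE : \sum_(i < k) \sum_(j < k | (j < i)%N) F i j =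
            \sum_(i < k) \sum_(j < k | (i < j)%N) F i j.
  rewrite (exchange_big_dep xpredT) //=.
  by apply: eq_bigr => i _; apply: eq_bigr => j _; rewrite FC.
have splitE (i : 'I_k) : \sum_j F i j = F i i +
    \sum_(j < k | (i < j)%N) F i j + \sum_(j < k | (j < i)%N) F i j.
  rewrite (bigD1 i) //= -addrA; congr (_ + _).
  rewrite (bigID (fun j : 'I_k => (i < j)%N)) /=; congr (_ + _);
    apply: eq_bigl => j; rewrite -val_eqE /=; by case: ltngtP.
rewrite [RHS](eq_bigr _ (fun i _ => splitE i)) big_split /= lowE -big_split /=.
apply: eq_bigr => i _; rewrite (bigD1 i) //= eqxx mul1r -addrA; congr (_ + _).
rewrite -big_split /=; apply: eq_big => [j|j /andP[_ /negPf ij]].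
  by rewrite -val_eqE /=; case: ltngtP.
by rewrite eq_sym ij mulr_natl mulr2n.
Qed.

(* Column stacking, [a = j * n + i] for row [i] and column [j]; [mxvec] would
   stack the rows. *)
Definition vec (R : realType) (n m : nat) (X : 'M[R]_(n, m)) :
    'cV[R]_(m * n) :=
  \col_a X (mxtens_unindex a).2 (mxtens_unindex a).1.

Definition kron (R : realType) (m n : nat) (u : 'cV[R]_m) (v : 'cV[R]_n) :
    'cV[R]_(m * n) := tensmx u v.

Lemma vec_kron (R : realType) (n m : nat) (X : 'M[R]_(n, m))
    (u : 'cV[R]_m) (v : 'cV[R]_n) :
  (vec X)^T *m kron u v = v^T *m X *m u.
Proof.
apply/matrixP => i0 j0; rewrite !ord1 {i0 j0} !mxE.
rewrite (reindex (@mxtens_index m n)) /=; last first.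
  by exists (@mxtens_unindex m n) => a _;
    rewrite (mxtens_indexK, mxtens_unindexK).
transitivity (\sum_(p : 'I_m * 'I_n)
    X p.2 p.1 * (u p.1 0 * v p.2 0)).
  by apply: eq_bigr => -[j i] _; rewrite !mxE !mxtens_indexK /= !ord1.
rewrite -(pair_bigA _ (fun j i => X i j * (u j 0 * v i 0))) /=.
apply: eq_bigr => j _; rewrite !mxE big_distrl /=; apply: eq_bigr => i _.
by rewrite mxE mulrA mulrAC [v i 0 * _]mulrC.
Qed.

Definition vintegral (R : realType) (k : nat) (a b : R) (f : R -> 'cV[R]_k) :
    'cV[R]_k :=
  \col_i (\int[@lebesgue_measure R]_(s in `[a, b]) f s i 0).

(* Row [k : 'I_N] of the data matrices belongs to the interval
   [t k, t k.+1]. *)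
Definition phibar (R : realType) (n N : nat) (t : nat -> R)
    (x : R -> 'cV[R]_n) : 'M[R]_(N, symdim n) :=
  \matrix_(k < N) (vintegral (t k) (t k.+1) (fun s => symkron (x s)))^T.

Definition mubar (R : realType) (n m N : nat) (t : nat -> R)
    (x : R -> 'cV[R]_n) (u : R -> 'cV[R]_m) : 'M[R]_(N, m * n) :=
  \matrix_(k < N) (vintegral (t k) (t k.+1) (fun s => kron (u s) (x s)))^T.

Definition psibar (R : realType) (n N : nat) (t : nat -> R)
    (x : R -> 'cV[R]_n) : 'M[R]_(N, symdim n) :=
  \matrix_(k < N) (symkron (x (t k.+1)) - symkron (x (t k)))^T.

Definition rhobar (R : realType) (n N : nat) (t : nat -> R)
    (x : R -> 'cV[R]_n) : 'cV[R]_N :=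
  \matrix_(k < N) ((x (t k.+1))^T *m x (t k.+1) - (x (t k))^T *m x (t k)).

Definition Deltamx (R : realType) (n m N : nat) (t : nat -> R)
    (x : R -> 'cV[R]_n) (u : R -> 'cV[R]_m) :
    'M[R]_(N, symdim n + m * n) :=
  row_mx (phibar N t x) (2 *: mubar N t x u).

Definition lsq (R : realType) (N q : nat) (D : 'M[R]_(N, q)) (y : 'cV[R]_N) :
    'cV[R]_q := invmx (D^T *m D) *m D^T *m y.

(* Main.v *)
(* Along the trajectory, [x^T X x] is absolutely continuous with derivative
   [x^T (A^T X + X A) x + 2 x^T X B u] almost everywhere, for every symmetric
   [X].  Integrating over each interval gives
   [psibar vecS X = Delta [vecS (A^T X + X A); vec (X B)]], so by full column
   rank least squares recovers these matrices exactly: [X = S] yields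
   [Gxx = A^T S + S A], and [X = 1] yields [Pi = A + A^T] and [Bhat = B].  The
   matrix inequality becomes [S A^T + A S - varpi B B^T < 0], which is the
   Lyapunov inequality [F S + S F^T < 0] for the closed loop [F = A - B K]. *)
Require Import Defs.
From HB Require Import structures.
From mathcomp Require Import all_boot all_order all_algebra.
From mathcomp Require Import all_classical all_reals all_analysis.
From mathcomp Require Import measurable_realfun complex mxtens ring lra.
Import Order.TTheory GRing.Theory Num.Theory.
Import numFieldNormedType.Exports.
Local Open Scope classical_set_scope.
Local Open Scope ring_scope.
Set Implicit Arguments.
Unset Strict Implicit.

(** * Real induction and absolutely continuous functions with zero derivative *)

(** Take [s] to be the supremum of the points where [P] holds. The step at [s] carries [P] from a
    point just below [s] either directly to [b] or to [s + e / 2], and the latter contradicts the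
    supremum. *)
Lemma real_induction (R : realType) (a b : R) (P : R -> Prop) :
  a <= b -> P a ->
  (forall s, a <= s <= b -> exists2 e, 0 < e & forall c d,
     a <= c -> c <= s -> s <= d -> d <= b -> s - e < c -> d < s + e ->
     P c -> P d) ->
  P b.
Proof.
move=> ab Pa step; pose E := [set c | a <= c <= b /\ P c].
have Ea : E a by rewrite /E /= lexx ab.
have supE : has_sup E by split; [exists a | exists b => c [/andP[]]].
have as_ : a <= sup E by apply: ub_le_sup => //; case: supE.
have sb : sup E <= b by apply: ge_sup; [exists a | move=> c [/andP[]]].
have [|e e0 Pstep] := step (sup E); first by rewrite as_ sb.
have [c [/andP[ac cb] Pc] ec] := sup_adherent e0 supE.
have cs : c <= sup E.
  by apply: ub_le_sup; [case: supE | split => //; rewrite ac].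
have sE d : sup E <= d -> d <= b -> d < sup E + e -> P d.
  by move=> sd db de; apply: (Pstep c d).
have [bs|sb'] := leP b (sup E + e / 2); first by apply: sE => //; lra.
have /(ub_le_sup (proj2 supE)) : E (sup E + e / 2).
  by split; [apply/andP; split; lra | apply: sE; lra].
by rewrite leNgt ltrDl divr_gt0.
Qed.

Lemma lebesgue_measure_bigitv (R : realType) (p : nat) (l r : 'I_p -> R) :
  (forall k, l k <= r k) ->
  trivIset setT (fun k => `]l k, r k[%classic) ->
  lebesgue_measure (\big[setU/set0]_(k < p) `]l k, r k[%classic) =
  (\sum_(k < p) (r k - l k))%:E.
Proof.
move=> lr tri; rewrite (measure_bigsetU_ord lebesgue_measure xpredT)//.
rewrite -sumEFin; apply: eq_bigr => k _.
rewrite [LHS](lebesgue_measure_itv `]l k, r k[)/= lte_fin.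
have := lr k; rewrite le_eqVlt => /orP[/eqP ->|->]; last by rewrite EFinB.
by rewrite ltxx subrr.
Qed.

(** The estimate is anchored at [s]: used on both sides, it controls the increment of [h] over any
    short interval straddling [s]. *)
Lemma derive0_lipschitz (R : realType) (h : R -> R) (s e : R) :
  is_derive s 1 h 0 -> 0 < e -> exists2 d : R, 0 < d &
  forall y, `|y - s| < d -> `|h y - h s| <= e * `|y - s|.
Proof.
move=> [dh h0] e0; move: dh => /cvg_ex [l hl].
have l0 : l = 0 by rewrite -h0; apply/esym/cvg_lim.
rewrite {}l0 in hl; move/cvgrPdist_lt : hl => /(_ e e0).
rewrite near_withinE => /nbhs_ballP [d /= d0 hd].
exists d => // y ys; have [->|yns] := eqVneq y s.
  by rewrite !subrr normr0 mulr0.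
have := hd (y - s); rewrite /ball /= sub0r normrN => /(_ ys).
rewrite subr_eq0 => /(_ yns).
rewrite sub0r normrN normrZ normfV [_%:A]mulr1 subrK => H.
apply: ltW; rewrite -ltr_pdivrMr ?normr_gt0 ?subr_eq0//.
by rewrite mulrC.
Qed.

(* Cover the null set where [h] fails to have derivative [0] by an open [U] of
   small measure; walking from [a] to [b], every short step either has slope at
   most [e] or stays inside [U]. *)
Lemma abs_continuous_derive0 (R : realType) (a b : R) (h : R -> R) :
  a <= b -> abs_continuous a b h ->
  {ae lebesgue_measure, forall s, s \in `[a, b] -> is_derive s 1 h 0} ->
  h b = h a.
Proof.
move=> ab hac [N [mN N0 hN]].
suff eP e : 0 < e -> `|h b - h a| <= e * (b - a) + e.
  apply/eqP; rewrite -subr_eq0 -normr_eq0; apply/negPn/negP => D0.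
  have Dgt : 0 < `|h b - h a| by rewrite lt_neqAle eq_sym D0 normr_ge0.
  (* Choosing for [e] the quotient of [|h b - h a|] by this number makes the bound equal to half of
     [|h b - h a|]. *)
  have ba1 : 0 < 2 * (b - a + 1) by lra.
  have := eP _ (divr_gt0 Dgt ba1); set q := _ / _.
  have -> : q * (b - a) + q = `|h b - h a| / 2 by rewrite /q; field; lra.
  lra.
move=> e0; have [d d0 hd] := hac e e0.
have [U [oU NU UN]] := lebesgue_regularity_outer mN (eq_ind_r
  (fun z => (z < +oo)%E) (ltry _) N0) d0.
have mU : measurable U by exact: open_measurable.
have Ud : (lebesgue_measure U < d%:E)%E.
  rewrite -(setDUK NU) measureU//; last 2 first.
    exact: measurableD.
    by rewrite setDE setIA [N `&` U]setIC -setIA setICr setI0.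
  by rewrite [X in (X + _ < _)%E]N0 add0e; exact: UN.
(* Invariant of the walk: the increment up to [c] is paid for by slope [e], except over finitely
   many intervals inside [U]. Keeping them ordered makes it easy to append one on the right. *)
pose Q c := exists p (l r : nat -> R),
  [/\ forall i, (i < p)%N ->
        [/\ a <= l i, l i <= r i, r i <= c & `]l i, r i[ `<=` U],
      forall i j, (i < j < p)%N -> r i <= l j &
      `|h c - h a| <= e * (c - a) + \sum_(i < p) `|h (r i) - h (l i)|].
have [|s sab|p [l [r [lr ord hba]]]] := @real_induction R a b Q ab.
- exists 0%N, (fun=> 0), (fun=> 0); split => //.
  by rewrite big_ord0 !subrr normr0; lra.
- have [Us|Us] := pselect (U s).
    have /nbhs_ballP [g /= g0 sgU] := open_nbhs_nbhs (conj oU Us).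
    exists g => // c x ac cs sx xb gc gx [p [l [r [lr ord hca]]]].
    (* The step from [c] to [x] stays inside [U], so it is recorded as interval number [p]. *)
    exists p.+1, (fun i => if (i < p)%N then l i else c),
      (fun i => if (i < p)%N then r i else x); split.
    + move=> i; rewrite ltnS leq_eqVlt => /predU1P[->|ip].
        rewrite ltnn; split => //; first exact: le_trans sx.
        move=> y /=; rewrite in_itv/= => /andP[cy yx]; apply: sgU.
        by rewrite /ball/= ltr_norml; apply/andP; split; lra.
      rewrite ip; have [? ? ? ?] := lr _ ip; split => //.
      by apply: (le_trans _ sx); apply: le_trans cs.
    + move=> i j /andP[ij]; rewrite ltnS leq_eqVlt => /predU1P[jp|jp].
        by rewrite jp ltnn -jp ij; have [] := lr i; rewrite -?jp.
      by rewrite (ltn_trans ij jp) jp; apply: ord; rewrite ij.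
    + rewrite big_ord_recr/= ltnn.
      rewrite (eq_bigr (fun i : 'I_p => `|h (r i) - h (l i)|)); last first.
        by move=> i _; rewrite ltn_ord.
      have -> : h x - h a = (h x - h c) + (h c - h a) by ring.
      apply: le_trans (ler_normD _ _) _.
      have : e * (c - a) <= e * (x - a) by rewrite ler_pM2l//; lra.
      lra.
  have dhs : is_derive s 1 h 0.
    apply: contrapT => ns; apply/Us/NU/hN => /= H.
    by apply/ns/H; rewrite in_itv.
  have [g g0 hg] := derive0_lipschitz dhs e0.
  exists g => // c x ac cs sx xb gc gx [p [l [r [lr ord hca]]]].
  exists p, l, r; split => //.
    move=> i /lr [? ? ? ?]; split => //.
    by apply: (le_trans _ sx); apply: le_trans cs.
  (* Since [c <= s <= x], the bounds [e * (x - s)] and [e * (s - c)] add up to [e * (x - c)]; the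
     list of intervals is unchanged. *)
  have -> : h x - h a = (h x - h s) - (h c - h s) + (h c - h a) by ring.
  apply: le_trans (ler_normD _ _) _.
  have hx := hg x; rewrite ger0_norm in hx; last by lra.
  have hc := hg c; rewrite ler0_norm in hc; last by lra.
  have := ler_normB (h x - h s) (h c - h s).
  have {}hx := hx ltac:(lra); have {}hc := hc ltac:(lra); lra.
have lr' (k : 'I_p) : l k <= r k by have [] := lr _ (ltn_ord k).
have tri : trivIset setT (fun k : 'I_p => `]l k, r k[%classic).
  move=> i j _ _ [y [/=]]; rewrite !in_itv/= => /andP[li ri] /andP[lj rj].
  apply/val_inj => /=; case: (ltngtP i j) => // ij.
    by have := ord i j; rewrite ij ltn_ord leNgt (lt_trans lj ri) => /(_ isT).
  by have := ord j i; rewrite ij ltn_ord leNgt (lt_trans li rj) => /(_ isT).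
(* The intervals are disjoint and lie in [U], so their total length is below [d] and absolute
   continuity applies. *)
have lt_e : \sum_(k < p) `|h (r k) - h (l k)| < e.
  apply: (hd p (l \o val) (r \o val)) => //=.
    by move=> k; have [] := lr _ (ltn_ord k).
  rewrite -lte_fin -(lebesgue_measure_bigitv lr')//.
  apply: le_lt_trans Ud; apply: le_measure; rewrite ?inE//.
    exact: bigsetU_measurable.
  elim/big_ind : _ => // [A B AU BU|k _]; first by rewrite subUset.
  by have [] := lr _ (ltn_ord k).
lra.
Qed.

(** * Calculus of absolutely continuous functions, up to the fundamental theorem *)

(** The integral of [|f|] over a set is small as soon as the measure of the set is small; this is
    applied to the union of the intervals. *)
Lemma abs_continuous_integral (R : realType) (a b : R) (f : R -> R) :
  lebesgue_measure.-integrable setT (EFin \o f) ->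
  abs_continuous a b
    (fun s => \int[lebesgue_measure]_(y in `]-oo, s]) f y).
Proof.
move=> intf e e0; have [d [d0 hd]] := integral_normr_continuous intf e0.
exists d => // p l r lr tri sd.
have lr' k : l k <= r k by have [_ []] := lr k.
have mI k : measurable (`]l k, r k[%classic : set R) by [].
have mf : measurable_fun setT f.
  by apply/measurable_EFinP; exact: measurable_int intf.
apply: le_lt_trans (hd (\big[setU/set0]_(k < p) `]l k, r k[%classic) _ _).
- rewrite [leRHS]/Rintegral ge0_integral_bigsetU//=; last 3 first.
  + exact: index_enum_uniq.
  + exact: sub_trivIset tri.
  + apply/measurable_EFinP; apply: measurableT_comp => //.
    exact: measurable_funTS.
  rewrite -sum_fine; last first.
    move=> k _; apply: integrable_fin_num => //.
    by apply: integrable_norm; exact: integrableS intf.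
  apply: ler_sum => k _.
  rewrite Rintegral_itvB//; last 2 first.
    exact: integrableS intf.
    by rewrite bnd_simp.
  apply: le_trans (le_normr_Rintegral _ _) _ => //.
    exact: integrableS intf.
  (* The difference of integrals lives on []l k, r k]]; dropping the right endpoint matches the
     disjoint open intervals. *)
  rewrite /Rintegral -integral_itv_bndo_bndc//.
  apply/measurable_EFinP; apply: measurableT_comp => //.
  exact: measurable_funTS.
- exact: bigsetU_measurable.
- by rewrite [ltLHS](lebesgue_measure_bigitv lr' tri) lte_fin.
Qed.

Lemma abs_continuousW (R : realType) (a b c d : R) (f : R -> R) :
  a <= c -> d <= b -> abs_continuous a b f -> abs_continuous c d f.
Proof.
move=> ac db fac e /fac[del del0 fdel]; exists del => // p l r lr.
by apply: fdel => k; have [cl [lrk rd]] := lr k; split; [lra|split; lra].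
Qed.

Lemma abs_continuous_cst (R : realType) (a b k : R) :
  abs_continuous a b (fun=> k).
Proof.
move=> e e0; exists 1 => // p l r _ _ _.
by rewrite big1 // => i _; rewrite subrr normr0.
Qed.

Lemma abs_continuousD (R : realType) (a b : R) (f g : R -> R) :
  abs_continuous a b f -> abs_continuous a b g ->
  abs_continuous a b (fun s => f s + g s).
Proof.
move=> fac gac e e0; have e2 : 0 < e / 2 by rewrite divr_gt0.
have [df df0 hf] := fac _ e2; have [dg dg0 hg] := gac _ e2.
exists (Num.min df dg) => [|p l r lr tri]; first by rewrite lt_min df0.
rewrite lt_min => /andP[/(hf p l r lr tri) {}hf /(hg p l r lr tri) {}hg].
rewrite [ltRHS]splitr; apply: le_lt_trans (ltrD hf hg).
rewrite -big_split/=; apply: ler_sum => k _.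
by rewrite opprD addrACA ler_normD.
Qed.

(** Families made of a single interval already give uniform continuity. *)
Lemma abs_continuous_within (R : realType) (a b : R) (f : R -> R) :
  abs_continuous a b f -> {within `[a, b], continuous f}.
Proof.
move=> fac; apply/subspace_continuousP => s /= sab.
apply/cvgrPdist_lt => e e0; have [d d0 hd] := fac e e0.
rewrite near_withinE; apply/nbhs_ballP; exists d => //= y.
rewrite /ball/= => ys yab.
move: sab yab; rewrite !in_itv/= => /andP[as_ sb] /andP[ay yb].
have osc l r : a <= l -> l <= r -> r <= b -> r - l < d -> `|f r - f l| < e.
  move=> al lr rb rld; have := hd 1%N (fun=> l) (fun=> r).
  rewrite !big_ord1; apply => //.
  by move=> i j _ _ _; rewrite !ord1.
have [sy|/ltW ys'] := leP s y.
  by rewrite distrC; apply: osc => //; rewrite ltr_norml in ys; lra.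
by apply: osc => //; rewrite ltr_norml in ys; lra.
Qed.

Lemma abs_continuous_bounded (R : realType) (a b : R) (f : R -> R) :
  abs_continuous a b f -> [bounded f s | s in `[a, b]].
Proof.
move=> /abs_continuous_within fc.
have /compact_bounded[M [_ Mf]] :=
  continuous_compact fc (@segment_compact R a b).
by exists M; split; rewrite ?num_real // => ? ? ? ?; exact: Mf.
Qed.

Lemma abs_continuousM (R : realType) (a b : R) (f g : R -> R) :
  abs_continuous a b f -> abs_continuous a b g ->
  abs_continuous a b (fun s => f s * g s).
Proof.
move=> fac gac.
have [Mf [_ /(_ (`|Mf| + 1)) bf]] := abs_continuous_bounded fac.
have [Mg [_ /(_ (`|Mg| + 1)) bg]] := abs_continuous_bounded gac.
(* The bounds hold for every number strictly above [Mf] and [Mg], hence the [+ 1], which also makes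
   [K] positive. Increments of the product are then at most [K] times the sum of the increments of
   the factors. *)
pose K := `|Mf| + `|Mg| + 1.
have K0 : 0 < K by rewrite /K; have := normr_ge0 Mf; have := normr_ge0 Mg; lra.
have fK s : a <= s <= b -> `|f s| <= K.
  move=> sab; apply: (@le_trans _ _ (`|Mf| + 1)).
    by apply: bf; [have := ler_norm Mf; lra|rewrite /= in_itv].
  by rewrite /K; have := normr_ge0 Mg; lra.
have gK s : a <= s <= b -> `|g s| <= K.
  move=> sab; apply: (@le_trans _ _ (`|Mg| + 1)).
    by apply: bg; [have := ler_norm Mg; lra|rewrite /= in_itv].
  by rewrite /K; have := normr_ge0 Mf; lra.
move=> e e0; have e2 : 0 < e / 2 / K by rewrite !divr_gt0.
have [df df0 hf] := fac _ e2; have [dg dg0 hg] := gac _ e2.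
exists (Num.min df dg) => [|p l r lr tri]; first by rewrite lt_min df0.
rewrite lt_min => /andP[/(hf p l r lr tri) {}hf /(hg p l r lr tri) {}hg].
have -> : e = K * (e / 2 / K + e / 2 / K) by field; lra.
have := ltrD hf hg; rewrite -(ltr_pM2l K0); apply: le_lt_trans.
rewrite -big_split/= mulr_sumr; apply: ler_sum => k _.
have [al [lrk rb]] := lr k.
have -> : f (r k) * g (r k) - f (l k) * g (l k) =
  (f (r k) - f (l k)) * g (l k) + f (r k) * (g (r k) - g (l k)) by ring.
apply: le_trans (ler_normD _ _) _; rewrite !normrM mulrDr mulrC lerD//.
  by rewrite ler_wpM2r// gK//; lra.
by rewrite ler_wpM2r// fK//; lra.
Qed.

Lemma abs_continuous_sum (R : realType) (a b : R) (I : Type) (s : seq I)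
    (f : I -> R -> R) :
  (forall i, abs_continuous a b (f i)) ->
  abs_continuous a b (fun y => \sum_(i <- s) f i y).
Proof.
move=> fac; elim: s => [|i s IH].
  by under eq_fun do rewrite big_nil; exact: abs_continuous_cst.
by under eq_fun do rewrite big_cons; exact: (abs_continuousD (fac i) IH).
Qed.

(** By Lebesgue differentiation, the indefinite integral of [g] has derivative [g] almost
    everywhere. Its difference with [f] is absolutely continuous with derivative zero almost
    everywhere, hence takes equal values at [a] and [b]. *)
Lemma abs_continuous_FTC2 (R : realType) (a b : R) (f g : R -> R) :
  a <= b -> abs_continuous a b f ->
  lebesgue_measure.-integrable `[a, b] (EFin \o g) ->
  {ae lebesgue_measure, forall s, s \in `[a, b] -> is_derive s 1 f (g s)} ->
  \int[lebesgue_measure]_(s in `[a, b]) g s = f b - f a.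
Proof.
move=> ab fac intg fg; pose G := g \_ `[a, b].
(* Extending [g] by zero makes it integrable on the whole line, so that the primitive can start at
   [-oo]. *)
have intG : lebesgue_measure.-integrable setT (EFin \o G).
  by move: intg; rewrite integrable_mkcond// restrict_EFin.
pose F s := \int[lebesgue_measure]_(y in `]-oo, s]) G y.
have intGy y : lebesgue_measure.-integrable `]-oo, y] (EFin \o G).
  exact: integrableS intG.
have dF : {ae lebesgue_measure, forall s, derivable F s 1 /\ derive1 F s = G s}.
  apply: FTC1Ny => //.
  by apply: open_integrable_locally => //; exact: openT.
have Fac : abs_continuous a b F by exact: abs_continuous_integral.
have h_cst : f b - F b = f a - F a.
  apply: (@abs_continuous_derive0 R a b (fun s => f s - F s)) => //.
    have -> : (fun s => f s - F s) = (fun s => f s + -1 * F s).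
      by apply/funext => s; rewrite mulN1r.
    apply: abs_continuousD => //; apply: abs_continuousM => //.
    exact: abs_continuous_cst.
  move: fg dF.
  apply: (@filterS2 _ _ (ae_filter_ringOfSetsType lebesgue_measure)).
  move=> s fgs [dFs Fs] sab.
  have := fgs sab => dfs.
  have dFs' : is_derive s 1 F (g s).
    by apply: DeriveDef => //; rewrite -derive1E Fs /G patchE mem_set.
  by rewrite -(subrr (g s)); exact: is_deriveB.
have -> : f b - f a = F b - F a by lra.
rewrite /F Rintegral_itvB//.
rewrite Rintegral_itv_obnd_cbnd; last exact: integrableS intG.
by apply: eq_Rintegral => y yab; rewrite /G patchE yab.
Qed.

(** * Recovering matrices from their vectorizations by least squares *)

(** [vecS] reads the lower triangle with nonzero weights [1] and [sqrt 2]; symmetry supplies the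
    upper triangle. *)
Lemma vecS_inj (R : realType) (k : nat) (S T : 'M[R]_k) :
  S^T = S -> T^T = T -> vecS S = vecS T -> S = T.
Proof.
move=> /matrixP Ssym /matrixP Tsym /matrixP eST; apply/matrixP => i j.
wlog ij : i j / (j <= i)%N => [low|].
  case/orP: (leq_total j i) => ji; first exact: low.
  by rewrite -Ssym -Tsym !mxE; exact: low.
pose p : tripos k := Sub (j, i) ij.
have := eST (enum_rank p) 0; rewrite !mxE enum_rankK /=.
by case: ifP => _; [rewrite !mul1r | apply: mulfI; rewrite sqrtr_eq0 -ltNge].
Qed.

Lemma vec_inj (R : realType) (n m : nat) : injective (@vec R n m).
Proof.
move=> X Y /matrixP eXY; apply/matrixP => i j.
by have := eXY (mxtens_index (j, i)) 0; rewrite !mxE mxtens_indexK.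
Qed.

Lemma cV_sqnorm_eq0 (R : realType) (k : nat) (v : 'cV[R]_k) :
  v^T *m v = 0 -> v = 0.
Proof.
move=> /matrixP /(_ 0 0); rewrite !mxE => v0; apply/matrixP => i j.
rewrite ord1 mxE {j}; move/eqP: v0.
rewrite (eq_bigr (fun i => v i 0 ^+ 2)) => [|l _]; last by rewrite mxE expr2.
rewrite psumr_eq0 => [|l _]; last exact: sqr_ge0.
by move=> /allP/(_ i (mem_index_enum _)) /=; rewrite sqrf_eq0 => /eqP.
Qed.

(** If [v *m (D^T *m D) = 0], then [D *m v^T] has squared norm zero, and full column rank forces
    [v = 0]. *)
Lemma gram_unitmx (R : realType) (N q : nat) (D : 'M[R]_(N, q)) :
  \rank D = q -> D^T *m D \in unitmx.
Proof.
move=> rD; rewrite -row_free_unit -kermx_eq0 -submx0; apply/row_subP => i.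
set v := row i _; have : v *m (D^T *m D) = 0.
  by apply/sub_kermxP; exact: row_sub.
move=> vDD; have {vDD} : (D *m v^T)^T *m (D *m v^T) = 0.
  by rewrite trmx_mul trmxK -mulmxA (mulmxA D^T) mulmxA vDD mul0mx.
move=> /cV_sqnorm_eq0 Dv; rewrite submx0; apply/eqP.
have rfD : row_free D^T by rewrite /row_free mxrank_tr rD.
apply: (row_free_inj rfD).
by rewrite mul0mx -[LHS]trmxK trmx_mul trmxK Dv trmx0.
Qed.

Lemma lsq_exact (R : realType) (N q : nat) (D : 'M[R]_(N, q)) (w : 'cV[R]_q) :
  \rank D = q -> lsq D (D *m w) = w.
Proof.
move=> rD; rewrite /lsq -mulmxA (mulmxA D^T) mulKmx//; exact: gram_unitmx.
Qed.

(** * Definite matrices and the Lyapunov criterion *)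

Lemma posdefmx_unit (R : realType) (n : nat) (P : 'M[R]_n) :
  posdefmx P -> P \in unitmx.
Proof.
move=> [_ Ppos]; rewrite -row_free_unit -kermx_eq0 -submx0; apply/row_subP => i.
set v := row i _; have vP : v *m P = 0 by apply/sub_kermxP; exact: row_sub.
rewrite submx0; apply/negPn/negP => v0.
have := Ppos v^T; rewrite trmxK vP mul0mx mxE ltxx.
by rewrite -(inj_eq trmx_inj) trmxK trmx0 => /(_ v0).
Qed.

(** Eigenvectors are row vectors here, so positivity is transferred from columns to rows. *)
Lemma posdefmx_row (R : realType) (n : nat) (P : 'M[R]_n) (p : 'rV[R]_n) :
  posdefmx P -> p != 0 -> 0 < (p *m P *m p^T) 0 0.
Proof.
move=> [_ Ppos] p0; rewrite -[in X in X *m P](trmxK p); apply: Ppos.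
by rewrite -(inj_eq trmx_inj) trmxK trmx0.
Qed.

(* Splitting a row eigenvector into real and imaginary parts [p] and [q], the
   imaginary part of the eigenvalue cancels in [p (F P + P F^T) p^T +
   q (F P + P F^T) q^T] because [P] is symmetric. *)
Lemma lyapunov_hurwitz (R : realType) (n : nat) (F P : 'M[R]_n) :
  posdefmx P -> negdefmx (F *m P + P *m F^T) -> hurwitz F.
Proof.
move=> Ppos Qneg z /eigenvalueP [v vF v0].
have Psym : P^T = P by case: Ppos.
set p : 'rV[R]_n := map_mx (@complex.Re R) v.
set q : 'rV[R]_n := map_mx (@complex.Im R) v.
set a := complex.Re z; set b := complex.Im z.
have vE j : v 0 j = (p 0 j +i* q 0 j)%C by rewrite !mxE; case: (v 0 j).
have vFE j : (v *m map_mx (real_complex R) F) 0 j =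
             ((p *m F) 0 j +i* (q *m F) 0 j)%C.
  rewrite !mxE.
  apply: (big_rec3 (fun c r s => c = (r +i* s)%C)) => // l y1 y2 y3 _ ->.
  rewrite vE; move: (p 0 l) (q 0 l) => pl ql.
  by rewrite [map_mx _ F l j]mxE -complexr0; simpc.
have zE : z = (a +i* b)%C by rewrite /a /b; case: (z).
have pF : p *m F = a *: p - b *: q.
  apply/rowP => j; move/rowP: vF => /(_ j); rewrite vFE !mxE vE zE.
  by case=> -> _; rewrite !mxE.
have qF : q *m F = a *: q + b *: p.
  apply/rowP => j; move/rowP: vF => /(_ j); rewrite vFE !mxE vE zE.
  by case=> _ ->; rewrite !mxE.
(* The two halves are transposes of each other, and a 1 by 1 matrix equals its transpose. *)
have quad (w : 'rV[R]_n) : (w *m (F *m P + P *m F^T) *m w^T) 0 0 =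
    ((w *m F) *m P *m w^T) 0 0 *+ 2.
  rewrite mulmxDr mulmxDl mxE mulr2n mulmxA; congr (_ + _).
  rewrite -[in RHS](trmxK (_ *m w^T)) [in RHS]mxE.
  by rewrite !trmx_mul trmxK Psym !mulmxA.
have pq : (q *m P *m p^T) 0 0 = (p *m P *m q^T) 0 0.
  rewrite -[in RHS](trmxK (_ *m q^T)) [in RHS]mxE.
  by rewrite !trmx_mul trmxK Psym mulmxA.
have sumE : (p *m (F *m P + P *m F^T) *m p^T) 0 0 +
            (q *m (F *m P + P *m F^T) *m q^T) 0 0 =
    a * ((p *m P *m p^T) 0 0 + (q *m P *m q^T) 0 0) *+ 2.
  rewrite !quad pF qF !mulmxBl !mulmxDl -!scalemxAl.
  have sc c (Y : 'M[R]_(1,1)) : (c *: Y) 0 0 = c * Y 0 0 by rewrite mxE.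
  have op (Y : 'M[R]_(1,1)) : (- Y) 0 0 = - Y 0 0 by rewrite mxE.
  have ad (Y Z : 'M[R]_(1,1)) : (Y + Z) 0 0 = Y 0 0 + Z 0 0 by rewrite mxE.
  by rewrite !(ad, op, sc) pq; ring.
have Pge (w : 'rV[R]_n) : 0 <= (w *m P *m w^T) 0 0.
  have [->|w0] := eqVneq w 0; first by rewrite !mul0mx mxE.
  exact: ltW (posdefmx_row Ppos w0).
have Qlt (w : 'rV[R]_n) : w != 0 -> (w *m (F *m P + P *m F^T) *m w^T) 0 0 < 0.
  move=> w0; have := posdefmx_row Qneg w0.
  by rewrite mulmxN mulNmx mxE oppr_gt0.
have Qle (w : 'rV[R]_n) : (w *m (F *m P + P *m F^T) *m w^T) 0 0 <= 0.
  have [->|w0] := eqVneq w 0; first by rewrite !mul0mx mxE.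
  exact: ltW (Qlt w w0).
(* As [v] is nonzero, [p] or [q] is nonzero, so one of the two nonpositive terms is strictly
   negative. *)
have Qsum : (p *m (F *m P + P *m F^T) *m p^T) 0 0 +
            (q *m (F *m P + P *m F^T) *m q^T) 0 0 < 0.
  have [p0|/Qlt p0] := eqVneq p 0; last by rewrite ltr_wnDr// Qle.
  have [q0|/Qlt q0] := eqVneq q 0; last by rewrite ltr_wnDl.
  case/eqP: v0; apply/rowP => j; rewrite vE p0 q0 !mxE; exact: erefl.
(* A nonnegative real part [a] would make the right-hand side of [sumE] nonnegative. *)
rewrite ltNge; apply/negP => a0; move: Qsum; rewrite sumE ltNge.
by rewrite mulrn_wge0// mulr_ge0// addr_ge0.
Qed.

(** * Quadratic forms along a trajectory *)

Lemma integrable_lincomb d (T : measurableType d) (R : realType)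
    (mu : {measure set T -> \bar R}) (D : set T) (I : Type) (s : seq I)
    (c : I -> R) (f : I -> T -> R) :
  measurable D -> (forall i, mu.-integrable D (EFin \o f i)) ->
  mu.-integrable D (EFin \o (fun y => \sum_(i <- s) c i * f i y)).
Proof.
move=> mD fint; apply: (eq_integrable mD
  (fun y => \sum_(i <- s) (c i)%:E * (f i y)%:E)%E).
  by move=> y _ /=; rewrite -sumEFin.
by apply: integrable_sum => // i _; exact: (integrableZl mD (c i) (fint i)).
Qed.

Lemma Rintegral_lincomb d (T : measurableType d) (R : realType)
    (mu : {measure set T -> \bar R}) (D : set T) (I : Type) (s : seq I)
    (c : I -> R) (f : I -> T -> R) :
  measurable D -> (forall i, mu.-integrable D (EFin \o f i)) ->
  \int[mu]_(y in D) (\sum_(i <- s) c i * f i y) =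
  \sum_(i <- s) c i * \int[mu]_(y in D) f i y.
Proof.
move=> mD fint; elim: s => [|i s IH].
  under eq_Rintegral do rewrite big_nil.
  by rewrite big_nil Rintegral_cst// mul0r.
rewrite big_cons -IH -RintegralZl// -RintegralD//.
- by apply: eq_Rintegral => y _; rewrite big_cons.
- exact: (integrableZl mD (c i) (fint i)).
- exact: integrable_lincomb.
Qed.

(** The expansion into coordinate products lets derivatives and absolute continuity be treated one
    coordinate at a time. *)
Lemma mulmx_quadE (R : realType) (n : nat) (S : 'M[R]_n) (v w : 'cV[R]_n) :
  (v^T *m S *m w) 0 0 = \sum_i \sum_j S i j * (v i 0 * w j 0).
Proof.
rewrite exchange_big mxE; apply: eq_bigr => j _.
by rewrite mxE mulr_suml; apply: eq_bigr => i _; rewrite mxE; ring.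
Qed.

Lemma is_derive_sum_fun (R : realType) (n : nat) (s : R) (f : 'I_n -> R -> R)
    (df : 'I_n -> R) :
  (forall i, is_derive s 1 (f i) (df i)) ->
  is_derive s 1 (fun y => \sum_(i < n) f i y) (\sum_(i < n) df i).
Proof.
move=> dfi; have -> : (fun y => \sum_(i < n) f i y) = \sum_(i < n) f i.
  by apply/funext => y; rewrite fct_sumE.
exact: is_derive_sum.
Qed.

Lemma is_derive_quad (R : realType) (n : nat) (S : 'M[R]_n) (s : R)
    (x : R -> 'cV[R]_n) (dx : 'cV[R]_n) :
  (forall i, is_derive s 1 (fun r => x r i 0) (dx i 0)) ->
  is_derive s 1 (fun r => ((x r)^T *m S *m x r) 0 0)
    ((dx^T *m S *m x s) 0 0 + ((x s)^T *m S *m dx) 0 0).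
Proof.
move=> xd; rewrite !mulmx_quadE -big_split/=.
have -> : (fun r => ((x r)^T *m S *m x r) 0 0) =
    (fun r => \sum_i \sum_j S i j * (x r i 0 * x r j 0)).
  by apply/funext => r; exact: mulmx_quadE.
apply: is_derive_sum_fun => i; rewrite -big_split/=.
apply: is_derive_sum_fun => j.
have := is_deriveZ (S i j) (is_deriveM (xd i) (xd j)).
by move=> /is_derive_eq; apply; rewrite /GRing.scale/=; ring.
Qed.

Lemma abs_continuous_quad (R : realType) (n : nat) (S : 'M[R]_n) (a b : R)
    (x : R -> 'cV[R]_n) :
  (forall i, abs_continuous a b (fun s => x s i 0)) ->
  abs_continuous a b (fun s => ((x s)^T *m S *m x s) 0 0).
Proof.
move=> xac; under eq_fun do rewrite mulmx_quadE.
have ac2 i j : abs_continuous a b (fun s => S i j * (x s i 0 * x s j 0)).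
  apply: abs_continuousM; first exact: abs_continuous_cst.
  exact: abs_continuousM.
have ac1 i := abs_continuous_sum (index_enum _) (ac2 i).
exact: (abs_continuous_sum (index_enum _) ac1).
Qed.

(** The derivative of the quadratic form along the flow is linear in the regressors [symkron x] and
    [kron u x], with constant coefficients; [vecS_symkron] and [vec_kron] translate each block. *)
Lemma quad_flow (R : realType) (n m : nat) (A S : 'M[R]_n) (B : 'M[R]_(n, m))
    (x : 'cV[R]_n) (u : 'cV[R]_m) :
  S^T = S ->
  ((A *m x + B *m u)^T *m S *m x) 0 0 + (x^T *m S *m (A *m x + B *m u)) 0 0 =
  \sum_a vecS (A^T *m S + S *m A) a 0 * symkron x a 0 +
  \sum_b (2 * vec (S *m B) b 0) * kron u x b 0.
Proof.
move=> Ssym.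
have Wsym : (A^T *m S + S *m A)^T = A^T *m S + S *m A.
  by rewrite linearD/= !trmx_mul trmxK Ssym addrC.
have -> : \sum_a vecS (A^T *m S + S *m A) a 0 * symkron x a 0 =
    (x^T *m (A^T *m S + S *m A) *m x) 0 0.
  rewrite -(vecS_symkron _ Wsym) mxE; apply: eq_bigr => a _.
  by rewrite [in RHS]mxE.
have -> : \sum_b (2 * vec (S *m B) b 0) * kron u x b 0 =
    2 * (x^T *m (S *m B) *m u) 0 0.
  rewrite -vec_kron mxE mulr_sumr; apply: eq_bigr => b _.
  by rewrite [in RHS]mxE mulrA.
(* The two input terms are transposes of each other, which is where the factor 2 on [vec (S *m B)]
   comes from. *)
have BuE : ((B *m u)^T *m S *m x) 0 0 = (x^T *m (S *m B) *m u) 0 0.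
  rewrite -[in RHS](trmxK (_ *m u)) [in RHS]mxE.
  by rewrite !trmx_mul trmxK Ssym !mulmxA.
rewrite linearD/= !mulmxDl !mulmxDr !mulmxDl.
have ad (Y Z : 'M[R]_(1, 1)) : (Y + Z) 0 0 = Y 0 0 + Z 0 0 by rewrite mxE.
rewrite !ad BuE trmx_mul !mulmxA; ring.
Qed.

Lemma trajectory_integrable_symkron (R : realType) (n m : nat) (A : 'M[R]_n)
    (B : 'M[R]_(n, m)) (a b : R) (x : R -> 'cV[R]_n) (u : R -> 'cV[R]_m) k :
  trajectory A B a b x u ->
  lebesgue_measure.-integrable `[a, b] (EFin \o (fun s => symkron (x s) k 0)).
Proof.
move=> [_ xac _]; apply: continuous_compact_integrable.
  exact: segment_compact.
apply: abs_continuous_within.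
pose p := val (enum_val k).
have -> : (fun s => symkron (x s) k 0) = (fun s =>
    (if p.1 == p.2 then 1 else Num.sqrt 2) * (x s p.2 0 * x s p.1 0)).
  by apply/funext => s; rewrite !mxE /= !mxE big_ord1 !mxE.
apply: abs_continuousM; first exact: abs_continuous_cst.
exact: abs_continuousM.
Qed.

(** The input is only integrable, but the state is continuous, hence bounded and measurable on
    [[a, b]], so their product is integrable. *)
Lemma trajectory_integrable_kron (R : realType) (n m : nat) (A : 'M[R]_n)
    (B : 'M[R]_(n, m)) (a b : R) (x : R -> 'cV[R]_n) (u : R -> 'cV[R]_m) k :
  trajectory A B a b x u ->
  lebesgue_measure.-integrable `[a, b]
    (EFin \o (fun s => kron (u s) (x s) k 0)).
Proof.
move=> [uint xac _]; set p := mxtens_unindex k.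
have xp : abs_continuous a b (fun s => x s p.2 0) by [].
have -> : (fun s => kron (u s) (x s) k 0) = (fun s => u s p.1 0 * x s p.2 0).
  by apply/funext => s; rewrite mxE !ord1.
apply: (integrableMl _ (uint p.1)) => //; last exact: abs_continuous_bounded.
apply: subspace_continuous_measurable_fun => //.
exact: abs_continuous_within.
Qed.

(** This is [quad_flow] integrated by [abs_continuous_FTC2]; the constant coefficients leave the
    integrals, which become the entries of one data row. *)
Lemma trajectory_quad (R : realType) (n m : nat) (A : 'M[R]_n)
    (B : 'M[R]_(n, m)) (a b : R) (x : R -> 'cV[R]_n) (u : R -> 'cV[R]_m)
    (S : 'M[R]_n) :
  a <= b -> trajectory A B a b x u -> S^T = S ->
  ((x b)^T *m S *m x b) 0 0 - ((x a)^T *m S *m x a) 0 0 =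
  ((vintegral a b (fun s => symkron (x s)))^T *m
     vecS (A^T *m S + S *m A)) 0 0 +
  2 * ((vintegral a b (fun s => kron (u s) (x s)))^T *m vec (S *m B)) 0 0.
Proof.
move=> ab xu Ssym; have [_ xac xd] := xu.
pose g1 s := \sum_k vecS (A^T *m S + S *m A) k 0 * symkron (x s) k 0.
pose g2 s := \sum_k (2 * vec (S *m B) k 0) * kron (u s) (x s) k 0.
have int1 : lebesgue_measure.-integrable `[a, b] (EFin \o g1).
  apply: integrable_lincomb => // k.
  exact: (trajectory_integrable_symkron k xu).
have int2 : lebesgue_measure.-integrable `[a, b] (EFin \o g2).
  apply: integrable_lincomb => // k.
  exact: (trajectory_integrable_kron k xu).
pose V s := ((x s)^T *m S *m x s) 0 0.
rewrite -[LHS]/(V b - V a).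
rewrite -(@abs_continuous_FTC2 R a b V (fun s => g1 s + g2 s))//.
- rewrite RintegralD// !Rintegral_lincomb//; last 2 first.
    by move=> k; exact: (trajectory_integrable_kron k xu).
    by move=> k; exact: (trajectory_integrable_symkron k xu).
  congr (_ + _); rewrite [in RHS]mxE.
    by apply: eq_bigr => k _; rewrite !mxE mulrC.
  rewrite mulr_sumr; apply: eq_bigr => k _.
  by rewrite [in RHS]mxE [in RHS]mxE; ring.
- exact: abs_continuous_quad.
- by apply: (integrableD _ int1 int2).
- move: xd; apply: (@filterS _ _ (ae_filter_ringOfSetsType lebesgue_measure)).
  move=> s xd sab.
  rewrite -quad_flow//; apply: is_derive_quad => i; exact: xd.
Qed.

(** * The linear equation satisfied by the data matrices *)

Lemma trajectoryW (R : realType) (n m : nat) (A : 'M[R]_n) (B : 'M[R]_(n, m))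
    (a b c d : R) (x : R -> 'cV[R]_n) (u : R -> 'cV[R]_m) :
  a <= c -> d <= b -> trajectory A B a b x u -> trajectory A B c d x u.
Proof.
move=> ac db [uint xac xd].
have sub s : s \in `[c, d] -> s \in `[a, b].
  by rewrite !in_itv/= => /andP[cs sd]; apply/andP; split; lra.
split => [j|i|].
- by apply: integrableS (uint j) => // s /sub.
- exact: abs_continuousW (xac i).
- move: xd; apply: (@filterS _ _ (ae_filter_ringOfSetsType lebesgue_measure)).
  by move=> s xd /sub/xd.
Qed.

Lemma psibar_Deltamx (R : realType) (n m N : nat)
    (A S : 'M[R]_n) (B : 'M[R]_(n, m)) (t : nat -> R)
    (x : R -> 'cV[R]_n) (u : R -> 'cV[R]_m) :
  (forall k : nat, (k < N)%N -> t k < t k.+1) ->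
  trajectory A B (t 0%N) (t N) x u -> S^T = S ->
  psibar N t x *m vecS S =
  Deltamx N t x u *m col_mx (vecS (A^T *m S + S *m A)) (vec (S *m B)).
Proof.
move=> tlt xu Ssym.
(* Monotonicity of the sampling times places each [[t k, t k.+1]] inside [[t 0, t N]], where the
   trajectory is given. *)
have tmono i j : (i <= j <= N)%N -> t i <= t j.
  move=> /andP[ij jN]; elim: j ij jN => [|j IH].
    by rewrite leqn0 => /eqP ->.
  rewrite leq_eqVlt => /predU1P[-> //|ij jN].
  by apply: le_trans (ltW (tlt _ jN)); apply: IH => //; exact: ltnW.
rewrite mul_row_col -scalemxAl; apply/matrixP => k j; rewrite (ord1 j) {j}.
have rowE p (X : 'M[R]_(N, p)) (y : 'cV[R]_p) :
  (X *m y) k 0 = (row k X *m y) 0 0 by rewrite -row_mul [RHS]mxE.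
rewrite rowE [RHS]mxE [in X in _ + X]mxE !rowE !rowK.
have tk : t k <= t k.+1 by apply/ltW/tlt.
have xuk : trajectory A B (t k) (t k.+1) x u.
  by apply: trajectoryW xu; apply: tmono; rewrite ?leqnn ?andbT//= ltnW.
rewrite -(trajectory_quad tk xuk Ssym) -!vecS_symkron//.
rewrite linearB/= mulmxBl.
have sw v : (symkron v)^T *m vecS S = ((vecS S)^T *m symkron v)^T.
  by rewrite trmx_mul trmxK.
by rewrite !sw !mxE.
Qed.

(** Since [v^T *m v] is the quadratic form of the identity, [psibar_Deltamx] with [S = 1] also
    covers the second least squares problem. *)
Lemma rhobar_psibar (R : realType) (n N : nat) (t : nat -> R)
    (x : R -> 'cV[R]_n) :
  rhobar N t x = psibar N t x *m vecS 1%:M.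
Proof.
apply/row_matrixP => k; rewrite row_mul !rowK linearB/= mulmxBl.
have sw v : v^T *m v = (symkron v)^T *m vecS (1%:M : 'M[R]_n).
  rewrite -[RHS]trmxK trmx_mul trmxK vecS_symkron ?trmx1//.
  by rewrite mulmx1 trmx_mul trmxK.
by rewrite !sw.
Qed.

(** * Stability of the closed loop *)

Unset Implicit Arguments.
Set Strict Implicit.
Local Close Scope classical_set_scope.

Theorem lemma2 (R : realType) (n m N : nat)
  (A : 'M[R]_n) (B : 'M[R]_(n, m)) (M sqrtM : 'M[R]_n)
  (hM : possemidefmx M) (hsqrtM : is_sqrtmx M sqrtM)
  (hobs : observable A sqrtM) (hstab : stabilizable A B)
  (t : nat -> R) (ht : forall k : nat, (k < N)%N -> t k < t k.+1)
  (x : R -> 'cV[R]_n) (u : R -> 'cV[R]_m)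
  (hxu : trajectory A B (t 0%N) (t N) x u)
  (hrank : \rank (Deltamx N t x u) = (symdim n + m * n)%N)
  (S : 'M[R]_n) (varpi : R)
  (Gxx Pi : 'M[R]_n) (Gxu Bhat : 'M[R]_(n, m))
  (hS : S^T = S) (hGxx : Gxx^T = Gxx) (hPi : Pi^T = Pi)
  (hG : col_mx (vecS Gxx) (vec Gxu) =
        lsq (Deltamx N t x u) (psibar N t x *m vecS S))
  (hPB : col_mx (vecS Pi) (vec Bhat) =
         lsq (Deltamx N t x u) (rhobar N t x))
  (hLMI : negdefmx (S *m Pi + Pi *m S - Gxx - varpi *: (Bhat *m Bhat^T)))
  (hSpos : posdefmx S) (hw : 0 < varpi) :
  hurwitz (A - B *m ((varpi / 2) *: (Bhat^T *m invmx S))).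
Proof.
(* [vecS_inj] requires both matrices to be symmetric. *)
have sym (X : 'M[R]_n) : X^T = X -> (A^T *m X + X *m A)^T = A^T *m X + X *m A.
  by move=> Xsym; rewrite linearD/= !trmx_mul trmxK Xsym addrC.
move: hG; rewrite (psibar_Deltamx ht hxu hS) lsq_exact// => /eq_col_mx[].
move=> /(vecS_inj hGxx (sym _ hS)) Gxx_eq _.
move: hPB; rewrite rhobar_psibar (psibar_Deltamx ht hxu (trmx1 _ _)).
rewrite lsq_exact// => /eq_col_mx[].
move=> /(vecS_inj hPi (sym _ (trmx1 _ _))) Pi_eq /vec_inj Bhat_eq.
rewrite mulmx1 !mul1mx in Pi_eq Bhat_eq.
rewrite Gxx_eq Pi_eq Bhat_eq in hLMI *.
(* The Lyapunov matrix is [S] itself, used on the side where it cancels the [invmx S] of the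
   gain. *)
apply: (lyapunov_hurwitz hSpos).
have Su := posdefmx_unit hSpos.
have BKS : B *m ((varpi / 2) *: (B^T *m invmx S)) *m S =
    (varpi / 2) *: (B *m B^T).
  by rewrite -scalemxAr -scalemxAl mulmxA mulmxKV.
(* In the matrix inequality, subtracting [A^T *m S + S *m A] leaves [S *m A^T + A *m S]. The two
   feedback terms contribute [varpi / 2] each, giving the full [varpi *: (B *m B^T)]. *)
suff -> : (A - B *m ((varpi / 2) *: (B^T *m invmx S))) *m S +
    S *m (A - B *m ((varpi / 2) *: (B^T *m invmx S)))^T =
    S *m (A^T + A) + (A^T + A) *m S - (A^T *m S + S *m A) -
    varpi *: (B *m B^T) by [].
have SKB : S *m (B *m ((varpi / 2) *: (B^T *m invmx S)))^T =
    (varpi / 2) *: (B *m B^T).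
  by rewrite -{1}hS -trmx_mul BKS linearZ/= trmx_mul trmxK.
rewrite linearB/= mulmxBl mulmxBr BKS SKB.
rewrite mulmxDr mulmxDl [in RHS](splitr varpi) scalerDl.
apply/matrixP => i j; rewrite !mxE; ring.
Qed.
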